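(* Let $g, h \in \mathbb{F}_2[x]$ and let $a,b \in \mathbb{F}_2[x]$. The element $a + by \in \mathbb{F}_2[x,y]/(y^2+gy+h)$ is a unit if and only if $(a,b)$ satisfies $$a^2 + abg + b^2h = 1 \quad \text{in } \mathbb{F}_2[x].$$ In this case, the inverse is given by $(a+by)^{-1} = (a+bg) + by$.
   Context: The ring $\mathbb{F}_2[x,y]/(y^2+gy+h)$ is a free $\mathbb{F}_2[x]$-module with basis $\{1,y\}$, so each of its elements can be written uniquely as $a+by$ with $a,b\in\mathbb{F}_2[x]$. *)

(* Defs.v *)
From HB Require Import structures.
From mathcomp Require Import all_boot all_algebra.
From mathcomp Require Import boolp.

Set Implicit Arguments.
Unset Strict Implicit.
Unset Printing Implicit Defensive.

Import GRing.Theory.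
Local Open Scope ring_scope.

(* F_2[x,y] is represented as F_2[x][y], i.e. {poly {poly 'F_2}}: the inner
   variable is x and the outer variable 'X is y. *)
Definition quad_poly (g h : {poly 'F_2}) : {poly {poly 'F_2}} :=
  'X^2 + g%:P * 'X + h%:P.

Lemma size_quad_poly g h : size (quad_poly g h) = 3.
Proof.
rewrite /quad_poly -addrA size_polyDl size_polyXn // ltnS.
apply: leq_trans (size_polyD _ _) _; rewrite geq_max.
by rewrite mul_polyC (leq_trans (size_scale_leq _ _)) ?size_polyX // size_polyC; case: eqP.
Qed.

Lemma monic_quad_poly g h : quad_poly g h \is monic.
Proof.
by rewrite monicE lead_coefE size_quad_poly /quad_poly !coefE /= mulr0 !addr0.
Qed.

(* {poly %/ p} silently replaces the modulus p by 'X when p is not monic of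
   positive degree; this does not happen here. *)
Lemma mk_monic_quad_poly g h : mk_monic (quad_poly g h) = quad_poly g h.
Proof. by rewrite /mk_monic size_quad_poly monic_quad_poly. Qed.

(* The F_2[x]-algebra F_2[x,y]/(y^2 + g y + h). *)
Definition quad_ring (g h : {poly 'F_2}) : Type := {poly %/ quad_poly g h}.

HB.instance Definition _ g h := GRing.ComNzRing.on (quad_ring g h).
HB.instance Definition _ g h := GRing.Algebra.on (quad_ring g h).

Definition quad_y g h : quad_ring g h := in_qpoly (quad_poly g h) 'X.

(* The library makes {poly %/ p} a unitRingType only over a field of
   coefficients. Here the units are, by definition, the invertible elements;
   membership is decided classically. *)
Section Units.
Variables g h : {poly 'F_2}.
Implicit Types u v : quad_ring g h.

Definition quad_unit : pred (quad_ring g h) :=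
  fun u => `[< exists v, v * u == 1 >].

Definition quad_inv u : quad_ring g h :=
  if pselect (exists v, v * u == 1) is left uV then xchoose uV else u.

Fact quad_mulVr : {in quad_unit, left_inverse 1 quad_inv *%R}.
Proof.
move=> u /asboolP uV; rewrite /quad_inv; case: pselect => // uV'.
exact/eqP/(xchooseP uV').
Qed.

Fact quad_unitP u v : v * u = 1 -> quad_unit u.
Proof. by move=> vu; apply/asboolP; exists v; apply/eqP. Qed.

Fact quad_inv_out : {in [predC quad_unit], quad_inv =1 id}.
Proof.
by move=> u /asboolP uN; rewrite /quad_inv; case: pselect.
Qed.

HB.instance Definition _ := GRing.ComNzRing_hasMulInverse.Build (quad_ring g h)
  quad_mulVr quad_unitP quad_inv_out.
End Units.

(* Main.v *)
Require Import Defs.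
From mathcomp Require Import all_boot all_algebra.
From mathcomp Require Import ring.
Import GRing.Theory.
Local Open Scope ring_scope.

(** Write u = a + b y, u' = (a + b g) + b y and N = a^2 + a b g + b^2 h. In
    characteristic 2, u u' = N, so N = 1 gives the inverse. Conversely, if
    u (c + d y) = 1 then u' = N (c + d y), so N divides both b and a + b g,
    hence also a, hence the constant coefficient a c + b d h = 1 of
    u (c + d y); and the only unit of F_2[x] is 1. *)

Lemma addrr_polyF2 (p : {poly 'F_2}) : p + p = 0.
Proof. by apply: addrr_pchar2; rewrite pchar_poly; apply: pchar_Fp. Qed.

Lemma oppr_polyF2 (p : {poly 'F_2}) : - p = p.
Proof. by apply/eqP; rewrite eq_sym -addr_eq0 addrr_polyF2. Qed.

(** A divisor of 1 is a nonzero constant, and the only nonzero element of ['F_2] is 1. *)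
Lemma polyF2_dvd1 (p : {poly 'F_2}) : p %| 1 -> p = 1.
Proof.
rewrite dvdp1 => /size_poly1P[c c0 ->]; congr _%:P.
by case: c c0 => [[|[|m]] //= ltm] _; apply: val_inj.
Qed.

Section QuadRing.
Variables g h : {poly 'F_2}.
Implicit Types (a b c d : {poly 'F_2}) (u : quad_ring g h).
Local Notation y := (quad_y g h).

(** The modulus has size 3, so a polynomial of degree at most 1 in y is its own remainder.
    Uniqueness of coordinates rests on this. *)
Lemma val_quad a b :
  polyn (a%:A + b *: y : quad_ring g h) = a%:P + b *: 'X :> {poly {poly 'F_2}}.
Proof.
rewrite -[polyn _]/(a *: polyn (1 : {poly %/ quad_poly g h}) + b *: polyn y).
rewrite /quad_y in_qpoly_small; last first.
  by rewrite mk_monic_quad_poly size_quad_poly size_polyX.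
by rewrite -[polyn 1]/(1%:P) alg_polyC.
Qed.

Lemma quad_inj a b c d :
  a%:A + b *: y = c%:A + d *: y -> a = c /\ b = d.
Proof.
move=> /(congr1 (fun u : quad_ring g h => polyn u)); rewrite !val_quad => e.
have := congr1 (fun p : {poly {poly 'F_2}} => p`_0) e.
have := congr1 (fun p : {poly {poly 'F_2}} => p`_1) e.
by rewrite !coefE /= !mulr0 !mulr1 !addr0 !add0r.
Qed.

Lemma quad_surj u : exists c d, u = c%:A + d *: y.
Proof.
have szu : (size (polyn u) <= 2)%N.
  rewrite -ltnS; apply: leq_trans (size_mk_monic u) _.
  by rewrite mk_monic_quad_poly size_quad_poly.
exists (polyn u)`_0, (polyn u)`_1; apply: val_inj; rewrite [RHS]val_quad /=.
apply/polyP => -[|[|i]]; rewrite !coefE /= ?mulr0 ?mulr1 ?addr0 ?add0r //.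
by rewrite nth_default // (leq_trans szu).
Qed.

(** The modulus reduces to 0, so y is a root of it; the signs disappear in characteristic 2. *)
Lemma quad_yy : y * y = h%:A + g *: y.
Proof.
have e : in_qpoly (quad_poly g h) (quad_poly g h) = 0.
  apply: val_inj => /=.
  by rewrite mk_monic_quad_poly Pdiv.RingMonic.rmodpp ?monic_quad_poly.
have {e} : y * y + g *: y + h%:A = 0.
  rewrite -[RHS]e [X in in_qpoly _ X]/quad_poly !raddfD /= expr2 in_qpolyM.
  rewrite mul_polyC linearZ /=.
  by rewrite -[h%:P]alg_polyC linearZ /= in_qpoly1.
move/eqP; rewrite -addrA addr_eq0 => /eqP ->.
by rewrite opprD addrC -!scaleNr !oppr_polyF2.
Qed.

Lemma quad_mul a b c d :
  (a%:A + b *: y) * (c%:A + d *: y) =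
  (a * c + b * d * h)%:A + (a * d + b * c + b * d * g) *: y.
Proof.
rewrite mulrDl !mulrDr -!scalerAl -!scalerAr !mul1r mulr1 quad_yy.
rewrite !scalerDr !scalerA !scalerDl.
(* Of the five expanded terms, the first and fourth are scalars; the others are multiples of y. *)
by rewrite (AC (2*(1*2)) (1*4*(2*3*5))).
Qed.

(** The second root of the modulus is y + g, so the second factor is the conjugate a + b (y + g) and
    the product is the norm. *)
Lemma quad_mul_conj a b :
  (a%:A + b *: y) * ((a + b * g)%:A + b *: y) =
  (a ^+ 2 + a * b * g + b ^+ 2 * h)%:A.
Proof.
rewrite quad_mul.
(* The coefficient of y is twice a b + b^2 g. *)
have -> : a * b + b * (a + b * g) + b * b * g = 0.
  rewrite [LHS](_ : _ = (a * b + b * b * g) + (a * b + b * b * g)); last by ring.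
  exact: addrr_polyF2.
by rewrite scale0r addr0; congr (_%:A); ring.
Qed.

Lemma quad_unit_norm a b : a%:A + b *: y \is a GRing.unit ->
  a ^+ 2 + a * b * g + b ^+ 2 * h = 1.
Proof.
set N := (X in X = 1); move=> uU.
have [c [d uV]] := quad_surj (a%:A + b *: y)^-1.
have cd1 : (a%:A + b *: y) * (c%:A + d *: y) = 1 by rewrite -uV divrr.
have : (N * c)%:A + (N * d) *: y = (a + b * g)%:A + b *: y.
  rewrite -!scalerA -scalerDr -[_ *: (_ + _)]mul1r -scalerAr scalerAl.
  by rewrite -quad_mul_conj mulrAC cd1 mul1r.
move=> /quad_inj[Nc Nd].
(* Writing 1 in coordinates lets the constant coefficient of the product be read off. *)
have /quad_inj[ac _] :
    (a * c + b * d * h)%:A + (a * d + b * c + b * d * g) *: y =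
    1%:A + 0 *: y.
  by rewrite -quad_mul cd1 scale0r addr0 scale1r.
have dvdb : N %| b by rewrite -Nd dvdp_mulr.
have dvda : N %| a.
  have : N %| a + b * g by rewrite -Nc dvdp_mulr.
  by rewrite dvdp_addl // dvdp_mulr.
by apply: polyF2_dvd1; rewrite -ac dvdp_add // -?mulrA dvdp_mulr.
Qed.

End QuadRing.

Theorem proposition4p1 (g h a b : {poly 'F_2}) :
  (a%:A + b *: quad_y g h \is a GRing.unit <->
     a ^+ 2 + a * b * g + b ^+ 2 * h = 1) /\
  (a%:A + b *: quad_y g h \is a GRing.unit ->
     (a%:A + b *: quad_y g h)^-1 = (a + b * g)%:A + b *: quad_y g h).
Proof.
have conjV : a ^+ 2 + a * b * g + b ^+ 2 * h = 1 ->
    (a%:A + b *: quad_y g h) * ((a + b * g)%:A + b *: quad_y g h) = 1.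
  by rewrite quad_mul_conj => ->; rewrite scale1r.
split; last first.
  move=> uU; have := conjV (quad_unit_norm _ _ _ _ uU).
  by move/(canRL (mulKr uU)); rewrite mulr1.
split=> [|N1]; first exact: quad_unit_norm.
(* By commutativity a right inverse suffices, and the conjugate is one. *)
apply/unitrPr; exists ((a + b * g)%:A + b *: quad_y g h); exact: conjV.
Qed.
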